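(* Every $\mathfrak{gl}_\infty$-module in the category $\mathcal{C}_{int}$ is completely reducible (i.e. is a direct sum of irreducible $\mathfrak{gl}_\infty$-submodules).
   Context: All vector spaces are over $\mathbb{C}$. $\mathfrak{gl}_\infty$ is the Lie algebra (under commutator) of doubly infinite matrices, indexed by $\mathbb{Z}\times\mathbb{Z}$, with only finitely many nonzero entries; it has basis $E_{m,n}$ ($m,n\in\mathbb{Z}$), the matrix units, with $[E_{m,n},E_{r,s}]=\delta_{n,r}E_{m,s}-\delta_{m,s}E_{r,n}$. A $\mathfrak{gl}_\infty$-module $W$ is integrable if every $E_{n,n}$ ($n\in\mathbb{Z}$) acts semisimply (diagonalizably) on $W$ and every $E_{p,q}$ with $p\neq q$ acts locally nilpotently on $W$. $\mathcal{C}$ is the category of $\mathfrak{gl}_\infty$-modules $W$ such that for every $w\in W$ there is a finite subset $S\subset\mathbb{Z}$ with $E_{m,n}w=0$ for all $m,n\in\mathbb{Z}$ with $n\notin S$. $\mathcal{C}_{int}$ is the subcategory of integrable modules in $\mathcal{C}$. *)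

(* Defs.v *)
From mathcomp Require Import all_boot all_order all_algebra.
From mathcomp Require Import finmap.
From mathcomp Require Export reals complex classical_sets.
From mathcomp Require Export monalg.

Set Implicit Arguments.
Unset Strict Implicit.
Unset Printing Implicit Defensive.

Import GRing.Theory.
Local Open Scope ring_scope.

(* Doubly infinite matrices with finitely many nonzero entries are finitely
   supported functions on int * int; A@_(m, n) is the (m, n) entry of A. *)
Definition gl_infty (K : fieldType) : lmodType K := {malg K[(int * int)%type]}.

Section GlInfty.
Variable K : fieldType.
Implicit Types A B : gl_infty K.

Definition gl_E (m n : int) : gl_infty K := << 1 *g (m, n) >>.

Definition gl_mul A B : gl_infty K :=
  \sum_(p <- msupp A) \sum_(q <- msupp B | q.1 == p.2)
     << A@_p * B@_q *g (p.1, q.2) >>.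

Definition gl_bracket A B : gl_infty K := gl_mul A B - gl_mul B A.

Lemma gl_mulE (m n r s : int) :
  gl_mul (gl_E m n) (gl_E r s) = if n == r then gl_E m s else 0.
Proof.
rewrite /gl_mul /gl_E !msuppU oner_eq0 big_seq_fset1 big_mkcond big_seq_fset1 /=.
by rewrite !mcoeffUU mulr1 eq_sym.
Qed.

Lemma gl_bracketE (m n r s : int) :
  gl_bracket (gl_E m n) (gl_E r s) =
    (n == r)%:R *: gl_E m s - (m == s)%:R *: gl_E r n.
Proof.
rewrite /gl_bracket !gl_mulE [s == m]eq_sym.
by case: eqP; case: eqP; rewrite ?scale1r ?scale0r.
Qed.

(* Entrywise, gl_mul is the usual matrix product; the sum may run over any
   finite set containing the column indices of A. *)
Lemma mcoeff_gl_mul A B (S : {fset int}) (m n : int) :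
    (forall p, p \in msupp A -> p.2 \in S) ->
  (gl_mul A B)@_(m, n) = \sum_(k <- S) A@_(m, k) * B@_(k, n).
Proof.
move=> sub_S.
have mcoeff_sum C k : C@_k = \sum_(p <- msupp C) C@_p *+ (p == k).
  rewrite {1}[C]monalgE raddf_sum /=.
  by apply: eq_bigr => p _; rewrite mcoeffU.
rewrite /gl_mul raddf_sum /=.
under [RHS]eq_bigr => k _ do rewrite [A@_(m, k)]mcoeff_sum mulr_suml.
rewrite exchange_big /= big_seq [RHS]big_seq; apply: eq_bigr => -[a b] Ap.
rewrite raddf_sum big_mkcond /= (bigD1_seq b) ?fset_uniq ?(sub_S _ Ap) //=.
rewrite [X in _ + X]big1 => [|k kb]; last first.
  by rewrite xpair_eqE [b == k]eq_sym (negPf kb) andbF mul0r.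
rewrite addr0 [B@_(b, n)]mcoeff_sum mulr_sumr; apply: eq_bigr => -[c d] _ /=.
rewrite mcoeffU !xpair_eqE eqxx andbT.
by case: (c == b); case: (a == m); case: (d == n) => /=; rewrite ?mulr0n ?mulr1n ?mulr0 ?mul0r.
Qed.
End GlInfty.

Section Modules.
Variables (K : fieldType) (W : lmodType K).

Definition is_gl_module (rho : gl_infty K -> W -> W) : Prop :=
  [/\ forall w, linear (fun A => rho A w),
      forall A, linear (rho A)
    & forall A B w, rho (gl_bracket A B) w = rho A (rho B w) - rho B (rho A w)].

Definition is_submodule (rho : gl_infty K -> W -> W) (N : set W) : Prop :=
  [/\ N 0,
      forall u v, N u -> N v -> N (u + v),
      forall (a : K) u, N u -> N (a *: u)
    & forall A u, N u -> N (rho A u)].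

Definition irreducible_submodule (rho : gl_infty K -> W -> W) (N : set W) :
    Prop :=
  [/\ is_submodule rho N,
      N <> [set 0]%classic
    & forall M : set W, is_submodule rho M -> (M `<=` N)%classic ->
        M = [set 0]%classic \/ M = N].

(* Intended for families N of linear subspaces of W. *)
Definition is_direct_sum (I : choiceType) (N : I -> set W) : Prop :=
  (forall w : W, exists (s : {fset I}) (f : I -> W),
     (forall i, N i (f i)) /\ w = \sum_(i <- s) f i) /\
  (forall (s : {fset I}) (f : I -> W),
     (forall i, N i (f i)) -> \sum_(i <- s) f i = 0 ->
     forall i, i \in s -> f i = 0).

Definition completely_reducible (rho : gl_infty K -> W -> W) : Prop :=
  exists (I : choiceType) (N : I -> set W),
    (forall i, irreducible_submodule rho (N i)) /\ is_direct_sum N.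

Definition eigenspace_of (T : W -> W) (a : K) : set W :=
  [set w | T w = a *: w]%classic.

Definition diagonalizable_op (T : W -> W) : Prop :=
  is_direct_sum (eigenspace_of T).

Definition locally_nilpotent (T : W -> W) : Prop :=
  forall w, exists k : nat, iter k T w = 0.

Definition integrable_module (rho : gl_infty K -> W -> W) : Prop :=
  (forall n : int, diagonalizable_op (rho (gl_E K n n))) /\
  (forall p q : int, p != q -> locally_nilpotent (rho (gl_E K p q))).

Definition in_C (rho : gl_infty K -> W -> W) : Prop :=
  forall w, exists S : {fset int},
    forall m n : int, n \notin S -> rho (gl_E K m n) w = 0.

Definition in_Cint (rho : gl_infty K -> W -> W) : Prop :=
  in_C rho /\ integrable_module rho.

End Modules.

(* Main.v *)
(** Write E(a,b) for the action of a matrix unit and V for the natural module.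
    Local nilpotency and sl_2 theory make every E(b,b) diagonalizable with
    eigenvalues in the naturals (the columns of a vector being finite, E(b,s)
    and E(s,s) kill it for fresh s), so every vector is a sum of vectors x of
    some degree d, i.e. with D x = d x for D the sum of the E(b,b). For fresh
    distinct q_1, ..., q_d, such an x lies in the submodule generated by the
    vectors E(q_1,g_1) ... E(q_d,g_d) x, because sum_b E(b,q) E(q,b) x = D x;
    and these vectors are multilinear: they have weight 1 on the q_i and 0
    elsewhere. On the multilinear vectors at indices s_1, ..., s_d the symmetric
    group acts by passing through fresh indices and back, and this space is a sum
    of minimal stable subspaces N by Maschke's theorem. Each N generates an
    irreducible submodule U: extracting d fresh positions from a vector of U lands
    in the copy of N at these positions, and a nonzero vector has a nonzero
    extraction, so a nonzero submodule of U meets N. Thus the module is a sum of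
    irreducible submodules, and Zorn's lemma makes the sum direct. *)

From HB Require Import structures.
Require Import Defs.
From mathcomp Require Import all_boot all_order all_algebra.
From mathcomp Require Import all_fingroup all_character.
From mathcomp Require Import finmap reals complex boolp classical_sets monalg.

Set Implicit Arguments.
Unset Strict Implicit.
Unset Printing Implicit Defensive.

Import Order.TTheory GRing.Theory Num.Theory.
Local Open Scope ring_scope.

(** * Linear subspaces as sets of vectors *)

Section Subspaces.
Variables (K : numFieldType) (W : lmodType K).

Definition subspace (X : set W) : Prop :=
  X 0 /\ forall a u v, X u -> X v -> X (a *: u + v).

Section Closure.
Variables (X : set W) (sX : subspace X).

Lemma subspace0 : X 0. Proof. by case: sX. Qed.

Lemma subspaceZ a u : X u -> X (a *: u).
Proof. by move=> Xu; rewrite -[a *: u]addr0; apply: sX.2 => //; apply: subspace0. Qed.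

Lemma subspaceD u v : X u -> X v -> X (u + v).
Proof. by move=> Xu Xv; rewrite -[u]scale1r; apply: sX.2. Qed.

Lemma subspaceB u v : X u -> X v -> X (u - v).
Proof. by move=> Xu Xv; rewrite -scaleN1r; apply: subspaceD => //; apply: subspaceZ. Qed.

Lemma subspace_sum (I : Type) (r : seq I) (P : pred I) (f : I -> W) :
  (forall i, P i -> X (f i)) -> X (\sum_(i <- r | P i) f i).
Proof.
move=> Xf; elim/big_rec: _ => [|i u /Xf]; first exact: subspace0.
by move=> Xfi Xu; apply: subspaceD.
Qed.

End Closure.

Lemma submodule_subspace rho (X : set W) : is_submodule rho X -> subspace X.
Proof. by case=> X0 XD XZ _; split=> // a u v Xu Xv; apply/XD/Xv/XZ. Qed.

End Subspaces.

(** * Semisimplicity of finite group actions *)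

Section Maschke.
Variables (K : numFieldType) (V : lmodType K) (gT : finGroupType).
Variables (T : gT -> V -> V) (M : set V).
Hypotheses (linT : forall g, linear (T g)) (sM : subspace M).
Hypothesis actM : forall g x, M x -> M (T g x).
Hypothesis act1 : forall x, M x -> T 1%g x = x.
Hypothesis actA : forall g h x, M x -> T g (T h x) = T (h * g)%g x.

HB.instance Definition _ g := GRing.isLinear.Build K V V *:%R (T g) (linT g).

(** These are the simple subrepresentations of [M], phrased with sets since [M] may be
    infinite-dimensional. *)
Definition minimal_stable (N : set V) :=
  [/\ subspace N, (N `<=` M)%classic, forall g x, N x -> N (T g x),
      exists2 x, N x & x <> 0
    & forall N' : set V, subspace N' -> (N' `<=` N)%classic ->
        (forall g x, N' x -> N' (T g x)) -> (exists2 x, N' x & x <> 0) ->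
        (N `<=` N')%classic].

Let G := [set: gT]%G.
Let rG := regular_repr K G.

(* The equivariant map from the regular representation sending 1 to m. *)
Let orbit_map m (v : 'rV[K]_(gcard G)) : V := \sum_i v 0 i *: T (enum_val i) m.

Let orbit_map_linear m : linear (orbit_map m).
Proof.
move=> a u v; rewrite /orbit_map scaler_sumr -big_split /=; apply: eq_bigr => i _.
by rewrite !mxE scalerDl scalerA.
Qed.

HB.instance Definition _ m :=
  GRing.isLinear.Build K _ V *:%R (orbit_map m) (orbit_map_linear m).

Let orbit_map_delta m g : orbit_map m 'e_(gring_index G g) = T g m.
Proof.
rewrite /orbit_map (bigD1 (gring_index G g)) //= mxE !eqxx scale1r.
rewrite gring_indexK ?inE // big1 ?addr0 // => i ig.
by rewrite mxE (negPf ig) andbF scale0r.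
Qed.

Let orbit_map_equivariant m g v : M m ->
  orbit_map m (v *m rG g) = T g (orbit_map m v).
Proof.
move=> Mm; rewrite [v in LHS]row_sum_delta mulmx_suml !linear_sum.
apply: eq_bigr => i _; rewrite -scalemxAl linearZ linearZ /=; congr (_ *: _).
by rewrite -rowE rowK orbit_map_delta actA.
Qed.

(** Any nonzero vector of a simple [U] generates it. A nonzero element of a stable subspace of the
    image comes from such a vector, so it generates the whole image. *)
Let image_minimal m U : M m -> mxsimple rG U ->
  forall v, (v <= U)%MS -> orbit_map m v <> 0 ->
  minimal_stable [set orbit_map m u | u in [set u | (u <= U)%MS]]%classic.
Proof.
move=> Mm simU v vU v0; have [modU _ _] := simU; split.
- split; first by exists 0; [exact: sub0mx|rewrite linear0].
  move=> a _ _ [u uU <-] [w wU <-]; exists (a *: u + w); last by rewrite linearP.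
  by apply: addmx_sub => //; apply: scalemx_sub.
- move=> _ [u _ <-]; apply: subspace_sum => // i _.
  by apply: subspaceZ => //; apply: actM.
- move=> g _ [u uU <-]; exists (u *m rG g); last exact: orbit_map_equivariant.
  by apply: mxmodule_trans => //; rewrite inE.
- by exists (orbit_map m v) => //; exists v.
move=> N' sN' N'U actN' [x N'x x0] _ [w wU <-].
have [u uU ux] := N'U x N'x.
have u0 : u != 0 by apply: contra_not_neq x0 => u0; rewrite -ux u0 linear0.
move: wU; rewrite /= (mxsimple_cyclic simU u0 uU) => /cyclic_mxP[A].
move=> /envelop_mxP[c ->] ->.
rewrite mulmx_sumr linear_sum; apply: subspace_sum => // g _.
rewrite -scalemxAr linearZ; apply: subspaceZ => //.
rewrite -[X in N' X]/(orbit_map m (u *m rG g)) orbit_map_equivariant // ux.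
exact: actN'.
Qed.

(** Each [m] is the image under [orbit_map m] of the basis vector at 1. In characteristic 0 the
    regular representation is a sum of simple modules, each of which maps to zero or onto a minimal
    stable subspace. *)
Lemma maschke (Z : set V) : subspace Z ->
  (forall N, minimal_stable N -> (N `<=` Z)%classic) -> (M `<=` Z)%classic.
Proof.
move=> sZ ZN m Mm.
have charG : pgroup.pgroup (negn [pchar K]) G.
  by rewrite /pgroup.pgroup /pnat cardG_gt0; apply/allP => p _; apply/negP; rewrite pchar_num.
(* The decomposition into simple modules is given under [classically], so the goal has to be a
   boolean. *)
apply/asboolP/(mx_reducible_semisimple (mxmodule1 rG) (mx_Maschke_pchar rG charG)).
case=> I U U1 simU defU _; apply/asboolP.
rewrite -(act1 Mm) -orbit_map_delta.
have sum1 : (('e_(gring_index G 1%g) : 'rV[K]_(gcard G)) <= \sum_i U i)%MS.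
  by apply: (submx_trans (submx1 _)); case/andP: (introT eqmxP defU).
have [u ->] := sub_sumsmxP sum1.
rewrite linear_sum; apply: subspace_sum => // i _ /=.
case: (pselect (orbit_map m (u i *m U i) = 0)) => [->|u0]; first exact: subspace0.
apply: (ZN _ (image_minimal Mm (simU i) (submxMl _ _) u0)).
by exists (u i *m U i) => //; apply: submxMl.
Qed.

End Maschke.

(** * Weights *)

Section Module.
Variables (K : numFieldType) (W : lmodType K) (rho : gl_infty K -> W -> W).
Hypothesis rhoP : is_gl_module rho.

Definition elem (a b : int) (x : W) : W := rho (gl_E K a b) x.
Notation E := elem.

Lemma elem_is_linear a b : linear (E a b).
Proof. by move=> k u v; case: rhoP => _ lin _; rewrite /elem lin. Qed.

HB.instance Definition _ a b :=
  GRing.isLinear.Build K W W *:%R (E a b) (@elem_is_linear a b).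

Lemma rho_lin a A B x : rho (a *: A + B) x = a *: rho A x + rho B x.
Proof. by case: rhoP => lin1 _ _; apply: lin1. Qed.

Lemma rho_0 x : rho 0 x = 0.
Proof.
have:= rho_lin 1 0 0 x; rewrite scaler0 addr0 scale1r -{1}[rho 0 x]addr0.
by move/addrI.
Qed.

Lemma rho_scale a A x : rho (a *: A) x = a *: rho A x.
Proof. by have:= rho_lin a A 0 x; rewrite addr0 rho_0 addr0. Qed.

Lemma elemC a b c e x :
  E a b (E c e x) =
    E c e (E a b x) + (b == c)%:R *: E a e x - (a == e)%:R *: E c b x.
Proof.
case: rhoP => _ _ /(_ (gl_E K a b) (gl_E K c e) x).
rewrite gl_bracketE addrC -scaleN1r scalerA mulN1r rho_lin rho_scale => brk.
rewrite -addrA [RHS]addrC; apply: (canRL (subrK _)).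
by rewrite /elem -brk addrC scaleNr.
Qed.

Lemma rho_elem A x :
  rho A x = \sum_(p <- msupp A) A@_p *: E p.1 p.2 x.
Proof.
rewrite {1}[A]monalgE; elim/big_rec2: _ => [|[a b] u v _ <-]; first exact: rho_0.
rewrite /elem -rho_lin; congr (rho (_ + _) x); move: A@__ => c; apply/malgP => q.
by rewrite mcoeffZ [LHS]mcoeffU (mcoeffU (a, b) 1); case: (_ == q); rewrite ?mulr1 ?mulr0.
Qed.

Lemma submodule_elem (X : set W) :
  subspace X -> (forall a b x, X x -> X (E a b x)) -> is_submodule rho X.
Proof.
move=> sX XE; split=> [|u v|a u|A u Xu].
- exact: subspace0.
- exact: subspaceD.
- exact: subspaceZ.
rewrite rho_elem; apply: subspace_sum => // p _.
by apply: subspaceZ => //; apply: XE.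
Qed.

Local Opaque elem.

(* On V^(x)d this counts the tensor factors with index in B. *)
Definition number_op (B : seq int) (x : W) : W := \sum_(b <- B) E b b x.
Notation D := number_op.

Lemma number_op_is_linear B : linear (D B).
Proof.
move=> a u v; rewrite /number_op scaler_sumr -big_split /=.
by apply: eq_bigr => b _; rewrite linearP.
Qed.

HB.instance Definition _ B :=
  GRing.isLinear.Build K W W *:%R (D B) (@number_op_is_linear B).

Lemma number_op1 b x : D [:: b] x = E b b x.
Proof. by rewrite /number_op big_seq1. Qed.

Lemma number_op_elem B a b x : uniq B ->
  D B (E a b x) = E a b (D B x) + ((a \in B)%:R - (b \in B)%:R) *: E a b x.
Proof.
elim: B => [_|c B IH /= /andP[cB uB]].
  by rewrite /number_op !big_nil linear0 subrr scale0r addr0.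
rewrite {1 2}/number_op !big_cons -!/(D _ _) IH // elemC linearD /= !in_cons.
have -> : (c == a)%:R *: E c b x = (c == a)%:R *: E a b x.
  by case: eqP => [->|]; rewrite ?scale0r.
have -> : (c == b)%:R *: E a c x = (c == b)%:R *: E a b x.
  by case: eqP => [->|]; rewrite ?scale0r.
rewrite -[_ + _ - _]addrA addrACA; congr (_ + _).
rewrite -scalerBl -scalerDl; congr (_ *: _).
have orD d : ((d == c) || (d \in B))%:R = (c == d)%:R + (d \in B)%:R :> K.
  by rewrite eq_sym; case: eqP => [<-|]; rewrite ?(negPf cB) ?addr0 ?add0r.
by rewrite !orD opprD addrACA.
Qed.

Lemma diag_elem c a b x :
  E c c (E a b x) = E a b (E c c x) + ((a == c)%:R - (b == c)%:R) *: E a b x.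
Proof. by rewrite -!number_op1 number_op_elem // !mem_seq1. Qed.

Lemma iter_elem_linear a b k : linear (iter k (E a b)).
Proof. by elim: k => [//|k IH] c u v; rewrite !iterS IH linearP. Qed.

Lemma diag_iter c a b k x :
  E c c (iter k (E a b) x) =
    iter k (E a b) (E c c x) + (k%:R * ((a == c)%:R - (b == c)%:R)) *: iter k (E a b) x.
Proof.
elim: k => [|k IH]; first by rewrite mul0r scale0r addr0.
rewrite iterS diag_elem IH linearD linearZ /= -addrA -scalerDl; congr (_ + _ *: _).
by rewrite -[k.+1]addn1 natrD mulrDl mul1r.
Qed.

(* sl_2 with e = E b s, f = E s b and h = E b b - E s s, where E s s x = 0. *)
Lemma raise_lower b s k x : s != b -> E b s x = 0 -> E s s x = 0 ->
  E b s (iter k.+1 (E s b) x) =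
    k.+1%:R *: iter k (E s b) (E b b x - k%:R *: x).
Proof.
move=> sb ex ssx; have linf := iter_elem_linear s b.
have fB j u v c : iter j (E s b) (u - c *: v) =
    iter j (E s b) u - c *: iter j (E s b) v.
  by rewrite -!scaleNr ![_ + (- c) *: _]addrC linf.
have f0 j : iter j (E s b) 0 = 0 by elim: j => //= j ->; rewrite linear0.
elim: k => [|k IH].
  rewrite /= elemC ex ssx linear0 add0r !eqxx !scale1r subr0 scale0r.
  by rewrite subr0.
rewrite iterS elemC IH !eqxx !scale1r !diag_iter ssx f0 add0r !eqxx.
rewrite (negPf sb) eq_sym (negPf sb) subr0 sub0r mulr1 mulrN1 !scaleNr.
rewrite linearZ_LR -iterS !fB.
set A := iter _ _ (E b b x); set C := iter _ _ x.
rewrite addrAC -scalerBr -addrA -opprD -[in RHS](addn1 k.+1) natrD scalerDl scale1r.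
suff -> : k%:R *: C + C = k.+1%:R *: C by [].
by rewrite -addn1 natrD scalerDl scale1r.
Qed.

(* Here and below, [X x -> Z x] for all subspaces Z containing the eigenvectors
   in X says that x is in the span of these eigenvectors. *)
Lemma sl2_eigenvectors b s k (X Z : set W) x : s != b ->
  subspace X -> (forall u, X u -> X (E b b u)) -> subspace Z ->
  (forall (j : nat) y, (j < k)%N -> X y -> E b b y = j%:R *: y -> Z y) ->
  X x -> E b s x = 0 -> E s s x = 0 -> iter k (E s b) x = 0 -> Z x.
Proof.
move=> sb sX XE; elim: k Z x => [|k IH] Z x sZ Zy Xx ex ssx fx.
  by rewrite (_ : x = 0) //; apply: subspace0.
(* By [raise_lower], [x'] is killed by the [k]-th power of [E s b]. By induction it is a sum of
   eigenvectors with eigenvalues below [k], where [E b b - k] is invertible. So [x'] is the image of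
   such a sum [z], and [x - z] is an eigenvector for [k]. *)
pose x' := E b b x - k%:R *: x.
have Xx' : X x' by apply: subspaceB => //; [apply: XE|apply: subspaceZ].
pose Z' : set W := [set y | exists2 z, Z z /\ X z & E b b z - k%:R *: z = y]%classic.
have : Z' x'.
  apply: IH => //.
  - split=> [|c _ _ [u [Zu Xu] <-] [v [Zv Xv] <-]].
      exists 0; first by split; apply: subspace0.
      by rewrite linear0 scaler0 subrr.
    exists (c *: u + v); first by split; [apply: sZ.2|apply: sX.2].
    rewrite linearP /= scalerBr scalerDr opprD addrACA; congr (_ - _ + _).
    by rewrite !scalerA mulrC.
  - move=> j y jk Xy ey.
    have jk0 : j%:R - k%:R != 0 :> K by rewrite subr_eq0 eqr_nat ltn_eqF.
    exists ((j%:R - k%:R)^-1 *: y); last first.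
      by rewrite linearZ /= ey !scalerA [k%:R * _]mulrC -scalerBl -mulrBr mulVf ?scale1r.
    by split; apply: subspaceZ => //; apply: Zy ey => //; apply: ltnW.
  - rewrite /x' linearB linearZ /= ex scaler0 subr0 elemC ex linear0 add0r.
    by rewrite (negPf sb) scale0r scaler0 subr0.
  - rewrite /x' linearB linearZ /= ssx scaler0 subr0 diag_elem ssx linear0 add0r.
    by rewrite subrr scale0r.
  - have := raise_lower k sb ex ssx; rewrite fx linear0 => /esym/eqP.
    by rewrite scaler_eq0 pnatr_eq0 => /eqP.
case=> z [Zz Xz] zx'; rewrite -[x](subrK z) addrC; apply: subspaceD => //.
apply: (Zy k) => //; first by apply: subspaceB.
by rewrite linearB scalerBr /= -[E b b z](subrK (k%:R *: z)) zx' opprD addrA subKr.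
Qed.

Lemma fresh_injection d (F : seq int) :
  exists2 r : 'I_d -> int, injective r & forall i, r i \notin F.
Proof.
pose N := (\max_(b <- F) `|b|%N).+1.
exists (fun i : 'I_d => Posz (N + i)) => [i j [/addnI/ord_inj]//|i].
apply/negP => iF; have := @leq_bigmax_seq _ _ xpredT absz _ iF isT.
by rewrite absz_nat leqNgt addSn ltnS leq_addr.
Qed.

Lemma fresh_elem (F : seq int) : exists s, s \notin F.
Proof. by have [r _ /(_ ord0)] := fresh_injection 1 F; exists (r ord0). Qed.

Hypothesis rhoC : in_Cint rho.

Lemma finite_columns x : exists S : {fset int}, forall a c, c \notin S -> E a c x = 0.
Proof. by case: rhoC => /(_ x) [S kS] _; exists S. Qed.

(** For a fresh [s] the finite columns give [E b s x = 0] and [E s s x = 0], and local nilpotency of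
    [E s b] supplies the exponent for [sl2_eigenvectors]. *)
Lemma diag_eigenvectors b (X Z : set W) x :
  subspace X -> (forall u, X u -> X (E b b u)) -> subspace Z ->
  (forall (j : nat) y, X y -> E b b y = j%:R *: y -> Z y) -> X x -> Z x.
Proof.
move=> sX XE sZ Zy Xx; have [S kS] := finite_columns x.
have [s] := fresh_elem (b :: S); rewrite inE negb_or => /andP[sb sS].
have [_ [_ /(_ s b sb x) [k fx]]] := rhoC.
apply: (@sl2_eigenvectors b s k X Z) => //; try exact: kS.
by move=> j y _; apply: Zy.
Qed.

(** Diagonal units commute, so the eigenspaces of the first one inside [X] are stable under the
    others; a general [X] lets the induction restrict to them. *)
Lemma joint_eigenvectors (B : seq int) (X Z : set W) x :
  subspace X -> (forall b u, b \in B -> X u -> X (E b b u)) -> subspace Z ->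
  (forall y, X y -> (forall b, b \in B -> exists j : nat, E b b y = j%:R *: y) -> Z y) ->
  X x -> Z x.
Proof.
elim: B X x => [|c B IH] X x sX XE sZ Zy; first by move=> Xx; apply: Zy.
apply: (@diag_eigenvectors c) => // [u|j y Xy ey]; first by apply: XE; apply: mem_head.
apply: (IH [set y | X y /\ E c c y = j%:R *: y]%classic) => //.
- split; first by split; [exact: subspace0|rewrite linear0 scaler0].
  move=> a u v [Xu eu] [Xv ev]; split; first exact: sX.2.
  by rewrite linearP /= eu ev scalerDr !scalerA mulrC.
- move=> b u bB [Xu eu]; split; first by apply: XE; rewrite ?in_cons ?bB ?orbT.
  by rewrite diag_elem eu linearZ /= subrr scale0r addr0.
move=> z [Xz ez] jz; apply: Zy => // b; rewrite in_cons => /orP[/eqP->|/jz//].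
by exists j.
Qed.

Lemma number_op_eigenvector (B : seq int) y :
  (forall b, b \in B -> exists j : nat, E b b y = j%:R *: y) ->
  exists2 n : nat, D B y = n%:R *: y & n = 0%N -> forall b, b \in B -> E b b y = 0.
Proof.
elim: B => [|c B IH] jy; first by exists 0%N => //; rewrite /number_op big_nil scale0r.
have [b bB|n ny n0] := IH; first by apply: jy; rewrite in_cons bB orbT.
have [j ey] := jy c (mem_head _ _); exists (j + n)%N.
  by rewrite /number_op big_cons -/(D _ _) ey ny -scalerDl natrD.
move/eqP; rewrite addn_eq0 => /andP[/eqP j0 /eqP/n0 Ey] b.
by rewrite in_cons => /orP[/eqP->|/Ey//]; rewrite ey j0 scale0r.
Qed.

Lemma number_op_eigenspace B c :
  subspace [set y | D B y = c *: y]%classic /\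
  (uniq B -> forall b u, D B u = c *: u -> D B (E b b u) = c *: E b b u).
Proof.
split; last by move=> uB b u eu; rewrite number_op_elem // eu linearZ subrr scale0r addr0.
split=> [|a u v /= eu ev]; first by rewrite /= linear0 scaler0.
by rewrite linearP /= eu ev scalerDr !scalerA mulrC.
Qed.

Lemma subspace_zero : subspace [set (0 : W)]%classic.
Proof. by split=> // a u v -> ->; rewrite scaler0 addr0. Qed.

(** The joint eigenvectors spanning this eigenspace have a natural [D B]-eigenvalue, so they all
    vanish. *)
Lemma number_op_neg B k u : uniq B -> D B u = - k.+1%:R *: u -> u = 0.
Proof.
move=> uB Du; have [sX XE] := number_op_eigenspace B (- k.+1%:R).
apply: (joint_eigenvectors (B := B) sX (fun b v _ => XE uB b v) subspace_zero _ Du).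
move=> y /= ey /number_op_eigenvector [n]; rewrite ey => /eqP.
rewrite scaleNr eq_sym -addr_eq0 -scalerDl -natrD scaler_eq0 pnatr_eq0 addnS.
by move=> /eqP.
Qed.

Lemma number_op_zero B m b : uniq B -> D B m = 0 -> b \in B -> E b b m = 0.
Proof.
move=> uB Dm bB; have [sX XE] := number_op_eigenspace B 0.
apply: (joint_eigenvectors (B := B) (Z := [set y | E b b y = 0]%classic) sX
  (fun b v _ => XE uB b v)).
- by split=> [|a u v /= eu ev]; rewrite /= ?linear0 // linearP /= eu ev scaler0 addr0.
- move=> y /= ey /number_op_eigenvector [n]; rewrite ey scale0r => /esym/eqP.
  rewrite scaler_eq0 pnatr_eq0 => /orP[/eqP n0 /(_ n0)/(_ b bB)//|/eqP->].
  by rewrite linear0.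
by rewrite /= scale0r.
Qed.

(** For [a != b], [E a b] would lower the weight at [b] from 0 to -1. *)
Lemma elem_weight0 a b y : E b b y = 0 -> E a b y = 0.
Proof.
move=> ey; case: (eqVneq a b) => [->//|ab].
apply: (@number_op_neg [:: b] 0) => //.
by rewrite number_op1 diag_elem ey linear0 add0r (negPf ab) eqxx sub0r.
Qed.

(** * Polarization *)

Section Polarization.
Variable I : finType.
Implicit Types (f g r s : I -> int) (l : seq I).

(* The product of the E (f i) (g i); the order matters unless the ranges of f
   and g are disjoint. *)
Fixpoint elems l f g (x : W) : W :=
  if l is i :: l' then elems l' f g (E (f i) (g i) x) else x.

Lemma elems_is_linear l f g : linear (elems l f g).
Proof. by elim: l => [//|i l IH] a u v /=; rewrite linearP IH. Qed.

HB.instance Definition _ l f g :=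
  GRing.isLinear.Build K W W *:%R (elems l f g) (@elems_is_linear l f g).

Lemma eq_elems l f g f' g' x :
  {in l, f =1 f'} -> {in l, g =1 g'} -> elems l f g x = elems l f' g' x.
Proof.
elim: l x => [//|i l IH] x ff gg /=; rewrite ff ?gg ?mem_head //.
by apply: IH => j jl; [apply: ff|apply: gg]; rewrite in_cons jl orbT.
Qed.

Lemma submodule_elems (X : set W) l f g x :
  is_submodule rho X -> X x -> X (elems l f g x).
Proof. by case=> _ _ _ XE; elim: l x => [//|i l IH] x Xx /=; apply/IH/XE. Qed.

Lemma number_op_elems B l f g x c : uniq B -> D B x = c *: x ->
  D B (elems l f g x) =
    (c + \sum_(i <- l) ((f i \in B)%:R - (g i \in B)%:R)) *: elems l f g x.
Proof.
move=> uB; elim: l x c => [|i l IH] x c Dx /=; first by rewrite big_nil addr0.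
rewrite big_cons addrA; apply: IH.
by rewrite number_op_elem // Dx linearZ /= -scalerDl.
Qed.

Lemma elem_comm a b c e x : b != c -> a != e -> E a b (E c e x) = E c e (E a b x).
Proof. by move=> /negPf bc /negPf ae; rewrite elemC bc ae !scale0r subr0 addr0. Qed.

Lemma elem_elems a b l f g x :
  (forall i, i \in l -> b != f i) -> (forall i, i \in l -> a != g i) ->
  E a b (elems l f g x) = elems l f g (E a b x).
Proof.
elim: l x => [//|i l IH] x bf ag /=.
rewrite IH; first last.
- by move=> j jl; apply: ag; rewrite in_cons jl orbT.
- by move=> j jl; apply: bf; rewrite in_cons jl orbT.
by rewrite elem_comm ?bf ?ag ?mem_head.
Qed.

Definition disjoint_ranges f g := forall i j, f i != g j.

Lemma perm_elems l l' f g x : disjoint_ranges f g -> perm_eq l l' ->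
  elems l f g x = elems l' f g x.
Proof.
move=> fg; have pull i k y : i \in k ->
    elems k f g y = elems (i :: rem i k) f g y.
  elim: k y => [//|j k IH] y; rewrite in_cons /=; case: eqVneq => [-> //|ij] /= ik.
  rewrite (IH _ ik) /=; congr elems.
  by rewrite elem_comm ?fg // eq_sym fg.
elim: l l' x => [|i l IH] l' x.
  by move=> /perm_size/esym/size0nil->.
move=> ll'; have il' : i \in l' by rewrite -(perm_mem ll') mem_head.
rewrite (pull i l') //=; apply: IH; rewrite -(perm_cons i).
exact: perm_trans ll' (perm_to_rem il').
Qed.

Lemma map_elems (h : I -> I) l f g x :
  elems (map h l) f g x = elems l (f \o h) (g \o h) x.
Proof. by elim: l x => [//|i l IH] x /=; apply: IH. Qed.

Lemma reindex_elems (sigma : {perm I}) f g x : disjoint_ranges f g ->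
  elems (enum I) (f \o sigma) (g \o sigma) x = elems (enum I) f g x.
Proof.
move=> fg; rewrite -map_elems; apply: perm_elems => //; apply: uniq_perm.
- by rewrite map_inj_uniq ?enum_uniq //; apply: perm_inj.
- exact: enum_uniq.
move=> i; rewrite mem_enum inE; apply/mapP; exists (sigma^-1%g i).
  by rewrite mem_enum.
by rewrite permKV.
Qed.

(** Each [E (f i) (r i)] moves inwards to meet [E (r i) (s i)], and their product is [E (f i) (s i)]
    because [m] has weight 0 at [r i]. The condition on [f] and [s] spares [i = j], so that [f = s]
    is allowed. *)
Lemma elems_comp l f r s m : uniq l -> injective r ->
  disjoint_ranges f r -> disjoint_ranges r s ->
  (forall i j, i != j -> f i != s j) ->
  (forall i, E (r i) (r i) m = 0) ->
  elems l f r (elems l r s m) = elems l f s m.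
Proof.
move=> + rI fr rs fs; elim: l m => [//|i l IH] m /= /andP[il ul] rm.
rewrite elem_elems; first last.
- by move=> j jl; apply: fs; apply: contraNneq il => ->.
- by move=> j jl; rewrite (inj_eq rI); apply: contraNneq il => ->.
have -> : E (f i) (r i) (E (r i) (s i) m) = E (f i) (s i) m.
  rewrite elemC eqxx scale1r (elem_weight0 (f i) (rm i)) // linear0 add0r.
  by rewrite rm scaler0 subr0.
apply: IH => // j; rewrite diag_elem rm linear0 add0r (negPf (fr _ _)).
by rewrite eq_sym (negPf (rs _ _)) subrr scale0r.
Qed.

(** For injective [s], in V^(x)d with d the size of [I], these vectors are spanned by the
    rearrangements of the tensor product of the basis vectors at the [s i]. *)
Definition multilinear s m := forall c, E c c m = (c \in codom s)%:R *: m.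

Lemma multilinear_subspace s : subspace [set m | multilinear s m]%classic.
Proof.
split=> [c|a u v mu mv c]; first by rewrite linear0 scaler0.
by rewrite linearP /= mu mv scalerDr !scalerA mulrC.
Qed.

Lemma multilinear_in s m i : multilinear s m -> E (s i) (s i) m = m.
Proof. by move->; rewrite codom_f scale1r. Qed.

Lemma multilinear_notin s m a c : multilinear s m -> c \notin codom s -> E a c m = 0.
Proof. by move=> ms /negPf cs; apply: elem_weight0; rewrite ms cs scale0r. Qed.

Lemma disjoint_ranges_notin r s i : disjoint_ranges r s -> r i \notin codom s.
Proof. by move=> rs; apply/negP => /codomP[j /eqP]; rewrite (negPf (rs _ _)). Qed.

Lemma sum_injective s c : injective s ->
  \sum_(i <- enum I) (s i == c)%:R = (c \in codom s)%:R :> K.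
Proof.
move=> sI; rewrite big_enum /=; case: (boolP (c \in codom s)) => [/codomP[i ->]|cs].
  rewrite (bigD1 i) //= eqxx big1 ?addr0 // => j ji.
  by rewrite (inj_eq sI) (negPf ji).
by rewrite big1 // => i _; case: eqP => // ic; rewrite -ic codom_f in cs.
Qed.

Lemma multilinear_elems r s m : injective r -> injective s ->
  multilinear s m -> multilinear r (elems (enum I) r s m).
Proof.
move=> rI sI ms c; rewrite -number_op1.
rewrite (@number_op_elems _ _ _ _ _ (c \in codom s)%:R) ?number_op1 //.
under eq_bigr => i do rewrite !mem_seq1.
by rewrite sumrB !sum_injective // addrC subrK.
Qed.

Lemma elems_diag l s m : multilinear s m -> elems l s s m = m.
Proof. by move=> ms; elim: l => [//|i l IH] /=; rewrite multilinear_in. Qed.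

(** The transfer from [s] to [r] can itself be routed through [r']; contracting [r] then leaves the
    route through [r']. Here [f] may meet [s], so the routes need not contract to a direct
    transfer. *)
Lemma elems_via r r' f s m : injective r -> injective r' -> injective s ->
  disjoint_ranges r s -> disjoint_ranges r' s -> disjoint_ranges r r' ->
  disjoint_ranges f r -> disjoint_ranges f r' -> multilinear s m ->
  elems (enum I) f r (elems (enum I) r s m) =
  elems (enum I) f r' (elems (enum I) r' s m).
Proof.
move=> rI r'I sI rs r's rr' fr fr' ms; have uI := enum_uniq I.
rewrite -(elems_comp (f := r) (r := r') (s := s)) //.
- apply: elems_comp => // i.
  apply: (multilinear_notin _ (multilinear_elems r'I sI ms)).
  exact: disjoint_ranges_notin.
- by move=> i; apply: (multilinear_notin _ ms); apply: disjoint_ranges_notin.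
Qed.

Lemma elems_back r s m : injective r -> injective s ->
  disjoint_ranges r s -> multilinear s m ->
  elems (enum I) s r (elems (enum I) r s m) = m.
Proof.
move=> rI sI rs ms; rewrite elems_comp ?enum_uniq ?elems_diag //.
- by move=> i j; rewrite eq_sym.
- by move=> i j ij; rewrite (inj_eq sI).
by move=> i; apply: (multilinear_notin _ ms); apply: disjoint_ranges_notin.
Qed.

(** Induction on [l]: each [E (r i) b x] has degree one less in [B], so it lies in [Z]. Applying
    [E b (r i)] and summing over [b] gives [D B x], a nonzero multiple of [x]. *)
Lemma elems_recover (Z : set W) (B : seq int) l r x :
  is_submodule rho Z -> uniq B -> uniq l -> injective r ->
  (forall i, r i \notin B) -> (forall i a, i \in l -> E a (r i) x = 0) ->
  D B x = (size l)%:R *: x ->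
  (forall g, (forall i, i \in l -> g i \in B) -> Z (elems l r g x)) -> Z x.
Proof.
move=> ZM uB + rI rB; elim: l x => [|i l IH] x /=.
  by move=> _ _ _ /(_ (fun=> 0)); apply.
move=> /andP[il ul] rx Dx Zx; have sZ := submodule_subspace ZM.
have Zb b : b \in B -> Z (E (r i) b x).
  move=> bB; apply: IH => // [j a jl||g gB].
  - have rjx a' : E a' (r j) x = 0 by apply: rx; rewrite in_cons jl orbT.
    rewrite elemC !rjx linear0 scaler0 subr0.
    rewrite add0r (inj_eq rI) (_ : (j == i) = false) ?scale0r //.
    by apply: contraNF il => /eqP<-.
  - rewrite number_op_elem // Dx linearZ /= (negPf (rB i)) bB -scalerDl.
    by rewrite sub0r -natr1 addrK.
  (* The choice [b] for [i] and the choices [g] on [l] are merged into one function. *)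
  pose g' j := if j == i then b else g j.
  have := Zx g'; rewrite (_ : g' i = b); last by rewrite /g' eqxx.
  rewrite (@eq_elems l r g' r g) //.
    apply=> j; rewrite in_cons /g'; case: (j == i) => //=; exact: gB.
  by move=> j jl; rewrite /g' (negPf (memPn il _ jl)).
have : Z ((size l).+1%:R *: x).
  rewrite -Dx /number_op big_seq; apply: subspace_sum => // b bB.
  have -> : E b b x = E b (r i) (E (r i) b x).
    have rix a : E a (r i) x = 0 by apply: rx; apply: mem_head.
    by rewrite elemC !rix linear0 !eqxx add0r scale1r scaler0 subr0.
  by case: ZM => _ _ _; apply; apply: Zb.
move=> /(subspaceZ sZ ((size l).+1%:R^-1)).
by rewrite scalerA mulVf ?pnatr_eq0 // scale1r.
Qed.

(** Every factor moves one index out of [B], so the degree in [B] drops to 0 and all weights there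
    vanish. Outside [B] only the new indices [r i] contribute. *)
Lemma multilinear_extract (B : seq int) r g y :
  uniq B -> (forall a c, c \notin B -> E a c y = 0) -> D B y = #|I|%:R *: y ->
  injective r -> (forall i, r i \notin B) -> (forall i, g i \in B) ->
  multilinear r (elems (enum I) r g y).
Proof.
move=> uB yB Dy rI rB gB c; case: (boolP (c \in B)) => cB.
  rewrite (number_op_zero uB _ cB).
    rewrite (_ : (c \in codom r) = false) ?scale0r //.
    by apply: contraTF cB => /codomP[i ->].
  rewrite (number_op_elems _ _ _ uB Dy).
  under eq_bigr => i do rewrite (negPf (rB i)) gB sub0r.
  by rewrite big_enum /= sumr_const mulNrn subrr scale0r.
rewrite -number_op1 (@number_op_elems _ _ _ _ _ 0) //; last first.
  by rewrite number_op1 yB // scale0r.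
congr (_ *: _); rewrite add0r -(sum_injective _ rI); apply: eq_bigr => i _.
by rewrite !mem_seq1 (negPf (memPn cB _ (gB i))) subr0.
Qed.

(** The vector [n] holds each index at most once. Extracting one too often gives a negative weight,
    hence 0; otherwise [g] is injective with values among those of [s], so it is a rearrangement of
    [s]. *)
Lemma elems_overweight r s g n : injective s -> multilinear s n ->
  disjoint_ranges r g ->
  elems (enum I) r g n = 0 \/ exists sigma : {perm I}, g =1 s \o sigma.
Proof.
move=> sI sn rg.
have [cg|/existsNP[c /negP]] :=
  pselect (forall c, (#|[pred i | g i == c]| <= (c \in codom s))%N).
  right; have gs i : g i \in codom s.
    have := cg (g i); case: (g i \in _) => //.
    by rewrite leqn0 => /pred0P/(_ i); rewrite /= eqxx.
  have gI : injective g.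
    move=> i j gij; have /card_le1_eqP := leq_trans (cg (g j)) (leq_b1 _).
    by apply; rewrite inE ?gij.
  pose h i := iinv (gs i).
  have sh i : s (h i) = g i by exact: f_iinv.
  have hI : injective h by move=> i j hij; apply: gI; rewrite -!sh hij.
  by exists (perm hI) => i; rewrite /= permE sh.
rewrite -ltnNge => /subnKC cg; left.
(* As a value of [g], [c] is not a value of [r], so the factors can only remove it. *)
have [i /= /eqP gi] : exists i, i \in [pred i | g i == c].
  by apply/card_gt0P; rewrite -cg addSn.
apply: (@number_op_neg [:: c] (#|[pred i | g i == c]| - (c \in codom s).+1)) => //.
rewrite (@number_op_elems _ _ _ _ _ (c \in codom s)%:R) ?number_op1 //.
congr (_ *: _); rewrite (eq_bigr (fun j => - (g j == c)%:R)); last first.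
  by move=> j _; rewrite !mem_seq1 -{1}gi (negPf (rg _ _)) sub0r.
rewrite sumrN big_enum /= -natr_sum.
rewrite (_ : (\sum_(j in I) (g j == c))%N = #|[pred i | g i == c]|); last first.
  rewrite -sum1_card [RHS]big_mkcond /=; apply: eq_bigr => j _.
  by rewrite inE; case: (g j == c).
by rewrite -{1}cg addSnnS natrD opprD addrA subrr sub0r.
Qed.

Lemma multilinear_perm s (sigma : {perm I}) m :
  multilinear (s \o sigma) m <-> multilinear s m.
Proof.
have sc c : (c \in codom (s \o sigma)) = (c \in codom s).
  apply/codomP/codomP => [[i ->]|[i ->]]; first by exists (sigma i).
  by exists (sigma^-1%g i); rewrite /= permKV.
by split=> ms c; have := ms c; rewrite sc.
Qed.

(** * The symmetric group action on multilinear vectors *)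

Section PermutationAction.
Variables s r : I -> int.
Hypotheses (sI : injective s) (rI : injective r) (rs : disjoint_ranges r s).

Let sr : disjoint_ranges s r. Proof. by move=> i j; rewrite eq_sym. Qed.
Let perm_inj_comp f (sigma : {perm I}) : injective f -> injective (f \o sigma).
Proof. by move=> fI i j /= /fI/perm_inj. Qed.

(* On V^(x)d this permutes the tensor factors; it is a right action. *)
Definition perm_act (sigma : {perm I}) m :=
  elems (enum I) (s \o sigma) r (elems (enum I) r s m).

Lemma perm_act_linear sigma : linear (perm_act sigma).
Proof. by move=> a u v; rewrite /perm_act !linearP. Qed.

Lemma perm_act_multilinear sigma m : multilinear s m -> multilinear s (perm_act sigma m).
Proof.
move=> ms; apply/(multilinear_perm _ sigma); apply: multilinear_elems => //.
  exact: perm_inj_comp.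
exact: multilinear_elems.
Qed.

Lemma perm_act1 m : multilinear s m -> perm_act 1 m = m.
Proof.
move=> ms; rewrite -[RHS](elems_back rI sI rs ms).
by apply: eq_elems => // i _ /=; rewrite perm1.
Qed.

(** By [elems_via] the actions may be routed through a fresh [q], where [tau] becomes a relabelling
    [q \o tau] that [reindex_elems] passes on to [sigma]. *)
Lemma perm_actM sigma tau m : multilinear s m ->
  perm_act sigma (perm_act tau m) = perm_act (tau * sigma) m.
Proof.
move=> ms.
have [q qI] : exists2 q : I -> int, injective q & forall i, q i \notin codom s ++ codom r.
  have [q qI qF] := fresh_injection #|I| (codom s ++ codom r).
  by exists (q \o enum_rank) => [i j /qI/enum_rank_inj|i] //=.
move=> qF; have qs : disjoint_ranges q s.
  move=> i j; apply: contraNneq (qF i) => ->.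
  by rewrite mem_cat codom_f.
have qr : disjoint_ranges q r.
  move=> i j; apply: contraNneq (qF i) => ->.
  by rewrite mem_cat codom_f orbT.
have sq : disjoint_ranges s q by move=> i j; rewrite eq_sym.
have uI := enum_uniq I.
have mr := multilinear_elems rI sI ms.
rewrite {1}/perm_act (elems_via (r' := q)) //; first last.
- exact: perm_act_multilinear.
- by move=> i j; apply: sq.
- by move=> i j; apply: sr.
- by move=> i j; rewrite eq_sym.
have -> : elems (enum I) q s (perm_act tau m) = elems (enum I) (q \o tau) s m.
  rewrite -(reindex_elems tau) // /perm_act elems_comp //; first last.
  - move=> i; apply: (multilinear_notin _ mr) => /=; exact: disjoint_ranges_notin.
  - by move=> i j _; apply: qr.
  - by move=> i j; apply: sr.
  - by move=> i j; apply: qs.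
  - exact: perm_inj_comp.
  rewrite elems_comp //; first last.
  - by move=> i; apply: (multilinear_notin _ ms); apply: disjoint_ranges_notin.
  - by move=> i j _; apply: qs.
  - by move=> i j; apply: qr.
rewrite -(reindex_elems tau) //; last by move=> i j; apply: sq.
rewrite /perm_act [RHS](elems_via (r' := q \o tau)) //; first last.
- by move=> i j; apply: sq.
- by move=> i j; apply: sr.
- by move=> i j; rewrite eq_sym; apply: qr.
- by move=> i j; apply: qs.
- exact: perm_inj_comp.
by apply: eq_elems => // i _ /=; rewrite permM.
Qed.

(** * The submodule generated by a minimal stable subspace *)

Variable N : set W.
Hypotheses (sN : subspace N) (mN : forall n, N n -> multilinear s n).
Hypothesis actN : forall sigma n, N n -> N (perm_act sigma n).

(** By [elems_overweight] the extraction is 0 or [g] is [s \o sigma]; in the second case the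
    rearrangement is absorbed by acting with the inverse of [sigma] on [n]. *)
Lemma elems_stable q g n : N n -> injective q ->
  disjoint_ranges q s -> disjoint_ranges q r -> disjoint_ranges q g ->
  exists2 n', N n' & elems (enum I) q g n = elems (enum I) q s n'.
Proof.
move=> Nn qI qs qr qg; have ms := mN Nn; have uI := enum_uniq I.
have [-> |[sigma gs]] := elems_overweight sI ms qg.
  by exists 0; [apply: subspace0|rewrite linear0].
exists (perm_act sigma^-1 n); first exact: actN.
rewrite -[RHS](reindex_elems sigma^-1%g) // /perm_act elems_comp //; first last.
- move=> i; apply: (multilinear_notin _ (multilinear_elems rI sI ms)) => /=.
  exact: disjoint_ranges_notin.
- by move=> i j _; apply: qr.
- by move=> i j; apply: sr.
- by move=> i j; apply: qs.
- exact: perm_inj_comp.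
rewrite elems_comp //; first last.
- by move=> i; apply: (multilinear_notin _ ms); apply: disjoint_ranges_notin.
- by move=> i j _; apply: qs.
- by move=> i j; apply: qr.
rewrite -(reindex_elems sigma^-1%g) //.
by apply: eq_elems => // i _ /=; rewrite gs /= permKV.
Qed.

(** Moving [E a b] out past [E (q i) (g i)] costs only a term with [g i = a], in which [b] is
    extracted instead: again an extraction of [x]. *)
Lemma elems_elem (Q : set W) l q a b x : subspace Q -> uniq l ->
  (forall i, q i != b) ->
  (forall g, disjoint_ranges q g -> Q (E a b (elems l q g x))) ->
  (forall g, disjoint_ranges q g -> Q (elems l q g x)) ->
  forall g, disjoint_ranges q g -> Q (elems l q g (E a b x)).
Proof.
move=> sQ + qb; elim: l x => [|i l IH] x; first by move=> _ Qx _ g /Qx.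
move=> /= /andP[il ul] QE Qx g qg.
pose upd c h j : int := if j == i then c else h j.
have upd_eq c h y : elems l q (upd c h) y = elems l q h y.
  by apply: eq_elems => // j jl; rewrite /upd (negPf (memPn il _ jl)).
have updi c h : upd c h i = c by rewrite /upd eqxx.
have upd_disj c h : (forall j, q j != c) -> disjoint_ranges q h -> disjoint_ranges q (upd c h).
  by move=> qc qh j k; rewrite /upd; case: (k == i).
rewrite elemC (negPf (qb i)) scale0r subr0 linearD linearZ /=.
apply: subspaceD => //; last first.
  apply: subspaceZ => //; have := Qx _ (upd_disj b g qb qg).
  by rewrite upd_eq updi.
apply: IH => // h qh.
  have := QE _ (upd_disj (g i) h (fun j => qg j i) qh).
  by rewrite upd_eq updi.
have := Qx _ (upd_disj (g i) h (fun j => qg j i) qh).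
by rewrite upd_eq updi.
Qed.

Definition gen_submodule : set W :=
  [set x | forall Z, is_submodule rho Z -> (N `<=` Z)%classic -> Z x]%classic.

Lemma gen_submoduleP : is_submodule rho gen_submodule.
Proof.
split=> [Z ZM _|u v Uu Uv Z ZM NZ|a u Uu Z ZM NZ|A u Uu Z ZM NZ].
- by case: ZM.
- by case: (ZM) => _ ZD _ _; apply: ZD; [apply: Uu|apply: Uv].
- by case: (ZM) => _ _ ZZ _; apply: ZZ; apply: Uu.
- by case: (ZM) => _ _ _ ZA; apply: ZA; apply: Uu.
Qed.

(* Extracting d tensor factors of x to fresh positions q lands in the copy of
   N at q: this submodule pins gen_submodule down in the weight of s. *)
Definition extraction : set W :=
  [set x | exists F : seq int, forall q, injective q -> (forall i, q i \notin F) ->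
     forall g, disjoint_ranges q g ->
     exists2 n, N n & elems (enum I) q g x = elems (enum I) q s n]%classic.

Lemma extractionP : is_submodule rho extraction.
Proof.
apply: submodule_elem.
  split=> [|a u v [F eu] [F' ev]].
    by exists [::] => q _ _ g _; exists 0; [apply: subspace0|rewrite !linear0].
  exists (F ++ F') => q qI qF g qg.
  have qF1 i : q i \notin F by have := qF i; rewrite mem_cat negb_or => /andP[].
  have qF2 i : q i \notin F' by have := qF i; rewrite mem_cat negb_or => /andP[].
  have [n Nn en] := eu q qI qF1 g qg; have [n' Nn' en'] := ev q qI qF2 g qg.
  by exists (a *: n + n'); [apply: sN.2|rewrite !linearP /= en en'].
move=> a b x [F ex]; exists (b :: codom s ++ F) => q qI qF.
have qb i : q i != b by have := qF i; rewrite inE negb_or => /andP[].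
have qs : disjoint_ranges q s.
  move=> i j; apply: contraNneq (qF i) => ->.
  by rewrite inE mem_cat codom_f orbT.
have qF' i : q i \notin F.
  by have := qF i; rewrite inE mem_cat !negb_or => /and3P[].
pose Q : set W := [set y | exists2 n, N n & y = elems (enum I) q s n]%classic.
have sQ : subspace Q.
  split=> [|c _ _ [n Nn ->] [n' Nn' ->]].
    by exists 0; [apply: subspace0|rewrite linear0].
  by exists (c *: n + n'); [apply: sN.2|rewrite linearP].
have Qx g : disjoint_ranges q g -> Q (elems (enum I) q g x) by apply: ex.
apply: (elems_elem (Q := Q)) => //; first exact: enum_uniq.
move=> g /Qx [n Nn ->].
(* The copy of [N] at [q] has weight 0 at [b], so [E a b] kills it. *)
rewrite (multilinear_notin _ (multilinear_elems qI sI (mN Nn))).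
  exact: subspace0.
by apply/negP => /codomP[i bq]; have := qb i; rewrite bq eqxx.
Qed.

Lemma extraction_sub : (N `<=` extraction)%classic.
Proof.
move=> n Nn; exists (codom s ++ codom r) => q qI qF g qg.
by apply: elems_stable => // i j; apply: contraNneq (qF i) => ->;
  rewrite mem_cat codom_f ?orbT.
Qed.

(** The degree operator is the infinite sum of all [E b b]; it is replaced by [D B] for all finite
    [B] that are large enough for the given vector. *)
Definition degree_space : set W :=
  [set x | exists F : seq int, forall B, uniq B -> {subset F <= B} ->
     D B x = #|I|%:R *: x]%classic.

Lemma degree_spaceP : is_submodule rho degree_space.
Proof.
apply: submodule_elem.
  split=> [|a u v [F eu] [F' ev]].
    by exists [::] => B _ _; rewrite linear0 scaler0.
  exists (F ++ F') => B uB FB; rewrite linearP /= eu // ?ev //.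
  - by rewrite scalerDr !scalerA mulrC.
  - by move=> c cF; apply: FB; rewrite mem_cat cF orbT.
  - by move=> c cF; apply: FB; rewrite mem_cat cF.
move=> a b x [F ex]; exists (a :: b :: F) => B uB FB.
rewrite number_op_elem // ex //; last first.
  by move=> c cF; apply: FB; rewrite !inE cF !orbT.
by rewrite !FB ?inE ?eqxx ?orbT // subrr scale0r addr0 linearZ.
Qed.

Lemma degree_space_sub : (N `<=` degree_space)%classic.
Proof.
move=> n Nn; exists (codom s) => B uB sB.
rewrite /number_op (eq_bigr _ (fun b _ => mN Nn b)) -scaler_suml; congr (_ *: _).
under eq_bigr => b _ do rewrite -sum_injective //.
rewrite exchange_big /= (eq_bigr (fun=> 1)); last first.
  move=> i _; rewrite (bigD1_seq (s i)) ?sB ?codom_f //= eqxx big1 ?addr0 // => b.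
  by rewrite eq_sym => /negPf->.
by rewrite big_enum /= sumr_const.
Qed.

Hypothesis N0 : exists2 n, N n & n <> 0.
Hypothesis minN : forall N' : set W, subspace N' -> (N' `<=` N)%classic ->
  (forall sigma n, N' n -> N' (perm_act sigma n)) ->
  (exists2 n, N' n & n <> 0) -> (N `<=` N')%classic.

Lemma gen_submodule_irreducible : irreducible_submodule rho gen_submodule.
Proof.
split=> [||M MM MU]; first exact: gen_submoduleP.
  case: N0 => n Nn n0 U0; apply: n0.
  suff : gen_submodule n by rewrite U0.
  by move=> Z _; apply.
case: (pselect (exists2 x, M x & x <> 0)) => [[x Mx x0]|M0]; last first.
  left; apply/seteqP; split=> [x Mx|_ ->]; last by case: MM.
  by apply: contrapT => x0; apply: M0; exists x.
right; apply/seteqP; split=> // u Uu; apply: (Uu M MM) => {u Uu}.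
have Melems l f g y : M y -> M (elems l f g y).
  exact: submodule_elems.
have [F1 ex] := MU x Mx _ extractionP extraction_sub.
have [F2 dx] := MU x Mx _ degree_spaceP degree_space_sub.
have [S kS] := finite_columns x.
pose B := undup (F2 ++ S).
have [q qI qF] : exists2 q : I -> int, injective q &
    forall i, q i \notin B ++ F1 ++ codom s ++ codom r.
  have [q qI qF] := fresh_injection #|I| (B ++ F1 ++ codom s ++ codom r).
  by exists (q \o enum_rank) => [i j /qI/enum_rank_inj|i] //=.
have qB i : q i \notin B by have := qF i; rewrite mem_cat negb_or => /andP[].
have qF1 i : q i \notin F1 by have := qF i; rewrite !mem_cat !negb_or => /and3P[].
have qs : disjoint_ranges q s.
  move=> i j; apply: contraNneq (qF i) => ->.
  by rewrite !mem_cat codom_f !orbT.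
(* If all extractions of [x] to [q] from indices in [B] vanished, [elems_recover] for the zero
   submodule would give [x = 0]. *)
have [n Nn [n0 Mn]] : exists2 n, N n & n <> 0 /\ M n.
  apply: contrapT => noN; apply: x0.
  have sub0 : is_submodule rho [set (0 : W)]%classic.
    apply: submodule_elem; first exact: subspace_zero.
    by move=> a b _ ->; rewrite linear0.
  apply: (elems_recover (B := B) (l := enum I) (r := q) sub0) => //.
  - exact: undup_uniq.
  - exact: enum_uniq.
  - move=> i a _; apply: kS; apply: contra (qB i) => qS.
    by rewrite mem_undup mem_cat qS orbT.
  - rewrite -cardE; apply: dx; first exact: undup_uniq.
    by move=> c cF; rewrite mem_undup mem_cat cF.
  move=> g gB; have qg : disjoint_ranges q g.
    by move=> i j; apply: contraNneq (qB i) => ->; apply: gB; rewrite mem_enum.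
  have [n Nn en] := ex q qI qF1 g qg.
  apply: contrapT => e0; apply: noN; exists n => //; split.
    by move=> n0; apply: e0; rewrite en n0 linear0.
  (* Carrying the extraction back from [q] to [s] recovers [n], by operators that preserve [M]. *)
  rewrite -(elems_back qI sI qs (mN Nn)) -en.
  by apply: (Melems _ _ _ _ (Melems _ _ _ _ _)).
have sM := submodule_subspace MM.
have NM : (N `<=` [set n | N n /\ M n])%classic.
  apply: minN; last by exists n.
  - split; first by split; apply: subspace0.
    by move=> a u v [Nu Mu] [Nv Mv]; split; [apply: sN.2|apply: sM.2].
  - by move=> u [].
  - move=> sigma u [Nu Mu]; split; first exact: actN.
    by apply: (Melems _ _ _ _ (Melems _ _ _ _ _)).
by move=> u /NM [].
Qed.

Lemma gen_submodule_sub : (N `<=` gen_submodule)%classic.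
Proof. by move=> n Nn Z _; apply. Qed.

End PermutationAction.
End Polarization.

(** * The socle, as the smallest submodule containing all irreducible ones *)

Definition in_socle (w : W) : Prop := forall Z : set W, is_submodule rho Z ->
  (forall N, irreducible_submodule rho N -> (N `<=` Z)%classic) -> Z w.

Lemma multilinear_in_socle (I : finType) (s : I -> int) m :
  injective s -> multilinear s m -> in_socle m.
Proof.
move=> sI ms Z ZM ZN.
have [r rI rs] : exists2 r : I -> int, injective r & disjoint_ranges r s.
  have [r rI rF] := fresh_injection #|I| (codom s).
  exists (r \o enum_rank) => [i j /rI/enum_rank_inj//|i j].
  by apply: contraNneq (rF (enum_rank i)) => /= ->; apply: codom_f.
apply: (maschke (T := perm_act s r) (M := [set m | multilinear s m]%classic)) ms => //.
- exact: perm_act_linear.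
- exact: multilinear_subspace.
- by move=> g x; apply: perm_act_multilinear.
- by move=> x; apply: perm_act1.
- by move=> g h x; apply: perm_actM.
- exact: submodule_subspace ZM.
move=> N [sN Nm actN N0 minN] n Nn.
apply: (ZN (gen_submodule N)); last exact: gen_submodule_sub.
exact: (gen_submodule_irreducible sI rI rs).
Qed.

Lemma all_in_socle w : in_socle w.
Proof.
move=> Z ZM ZN; have [S kS] := finite_columns w; have uS := fset_uniq S.
pose X : set W := [set x | forall a c, c \notin S -> E a c x = 0]%classic.
apply: (joint_eigenvectors (B := S) (X := X)) kS.
- split=> [a c _|k u v Xu Xv a c cS]; first by rewrite linear0.
  by rewrite linearP /= Xu // Xv // scaler0 addr0.
- move=> b u bS Xu a c cS; rewrite elemC (Xu a) // (Xu b c) // linear0 scaler0 subr0 add0r.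
  by rewrite eq_sym (negPf (memPn cS _ bS)) scale0r.
- exact: submodule_subspace ZM.
move=> y Xy /number_op_eigenvector [d Dy _].
(* The degree [d] of [y] is a natural number, which tells how many fresh indices to take. *)
have [q qI qS] := fresh_injection d S.
apply: (elems_recover (B := S) (l := enum 'I_d) (r := q)) => //.
- exact: enum_uniq.
- by move=> i a _; apply: Xy.
- by rewrite size_enum_ord.
move=> g gS; apply: multilinear_in_socle ZM ZN => //; first exact: qI.
apply: (multilinear_extract (B := S)) => //; first by rewrite card_ord.
by move=> i; apply: gS; rewrite mem_enum.
Qed.

End Module.

(** * From sums to direct sums *)

Section DirectSum.
Variables (K : fieldType) (W : lmodType K) (rho : gl_infty K -> W -> W).
Hypothesis rhoL : forall A, linear (rho A).

(** Families are sets of subspaces, not indexed families, so that Zorn's lemma applies to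
    inclusion. *)
Definition independent (F : set (set W)) : Prop :=
  forall (l : seq (set W)) (f : set W -> W), uniq l ->
    (forall N, N \in l -> F N /\ N (f N)) ->
    \sum_(N <- l) f N = 0 -> forall N, N \in l -> f N = 0.

Definition irreducible_family (F : set (set W)) : Prop :=
  (forall N, F N -> irreducible_submodule rho N) /\ independent F.

Lemma maximal_irreducible_family : exists F, irreducible_family F /\
  forall F', (F `<` F')%classic -> ~ irreducible_family F'.
Proof.
apply: Zorn_bigcup => C CP Ctot; split; first by move=> N [F /CP[irr _]]; apply: irr.
move=> l f ul lC.
(* A finite list from the union of a chain lies in one member; the empty list is kept apart because
   the chain may be empty. *)
have : l = [::] \/ exists2 F, C F & forall N, N \in l -> F N.
  elim: l lC {ul} => [|N l IH] lC; first by left.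
  right; have [[F CF FN] _] := lC N (mem_head _ _).
  case: IH => [M Ml|->|[F' CF' F'l]]; first by apply: lC; rewrite in_cons Ml orbT.
    by exists F => // M; rewrite mem_seq1 => /eqP->.
  case: (Ctot F F' CF CF') => sub; [exists F'|exists F] => // M;
    rewrite in_cons => /orP[/eqP->|/F'l] //; [exact: sub|exact: sub].
case=> [->//|[F CF Fl]] sum0 N Nl; have [_ indF] := CP F CF.
by apply: indF sum0 N Nl => // N Nl; split; [apply: Fl|case: (lC N Nl)].
Qed.

Definition span_family (F : set (set W)) : set W :=
  [set w | forall Z, is_submodule rho Z -> (forall N, F N -> (N `<=` Z)%classic) ->
     Z w]%classic.

Lemma span_familyP F : is_submodule rho (span_family F).
Proof.
split=> [Z [? _ _ _] _ //|u v Fu Fv Z ZM NZ|a u Fu Z ZM NZ|A u Fu Z ZM NZ].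
- by case: (ZM) => _ ZD _ _; apply: ZD; [apply: Fu|apply: Fv].
- by case: (ZM) => _ _ ZZ _; apply: ZZ; apply: Fu.
- by case: (ZM) => _ _ _ ZA; apply: ZA; apply: Fu.
Qed.

Lemma span_family_sub F N : F N -> (N `<=` span_family F)%classic.
Proof. by move=> FN w Nw Z _ /(_ N FN); apply. Qed.

(** If [L] is not inside the span, it meets it in 0. Then in any relation the term in [L] lies in
    the span, so it is 0, and adding [L] keeps the family independent, against maximality. *)
Lemma irreducible_sub_span F L : irreducible_family F ->
  (forall F', (F `<` F')%classic -> ~ irreducible_family F') ->
  irreducible_submodule rho L -> (L `<=` span_family F)%classic.
Proof.
move=> [irrF indF] maxF irrL; have [LM L0 minL] := irrL.
have [S0 SD SZ SA] := span_familyP F; have [LL0 LD LZ LA] := LM.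
have LS : is_submodule rho (L `&` span_family F)%classic.
  split=> [|u v [? ?] [? ?]|a u [? ?]|A u [? ?]]; split; by auto.
case: (minL _ LS (@subIsetl _ _ _)) => [LS0|<-]; last exact: subIsetr.
case: (maxF (F `|` [set L])%classic).
  split=> [N FN|sub]; first by left.
  have /span_family_sub LF : F L by apply: sub; right.
  by apply: L0; rewrite -LS0 setIidl.
split=> [N [/irrF//|->//]|l f ul lF sum0].
case: (boolP (L \in l)) => [Ll|nLl]; last first.
  apply: indF sum0 => // N Nl; have [[FN|NL] fN] := lF N Nl => //.
  by rewrite -NL Nl in nLl.
have lF' N : N \in rem L l -> F N /\ N (f N).
  rewrite mem_rem_uniq // inE => /andP[/eqP NL Nl].
  by have [[FN|//] fN] := lF N Nl.
move: sum0; rewrite (big_rem L) //= => sum0.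
have S_rem : span_family F (\sum_(N <- rem L l) f N).
  rewrite big_seq; elim/big_rec: _ => // N u /lF'[FN fN] Su.
  by apply: SD => //; apply: span_family_sub fN.
have fL : f L = 0.
  have : (L `&` span_family F)%classic (f L).
    split; first by case: (lF L Ll).
    by move/eqP: sum0; rewrite addr_eq0 => /eqP->; rewrite -scaleN1r; apply: SZ.
  by rewrite LS0.
move: sum0; rewrite fL add0r => sum0 N Nl.
case: (eqVneq N L) => [->//|NL].
by apply: (indF _ _ (rem_uniq L ul) lF' sum0); rewrite mem_rem_uniq // inE NL.
Qed.

Lemma completely_reducible_of_socle :
  (forall w Z, is_submodule rho Z ->
    (forall N, irreducible_submodule rho N -> (N `<=` Z)%classic) -> Z w) ->
  completely_reducible rho.
Proof.
move=> socle; have [F [PF maxF]] := maximal_irreducible_family.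
have [irrF indF] := PF.
pose I := {N : set W | N \in F}.
have FI (i : I) : F (val i) by apply: set_mem (valP i).
have N0 (i : I) : val i 0 by have [[]] := irrF _ (FI i).
exists I, val; split=> [i|]; first exact: irrF.
split=> [w|s f Nf sum0 i si].
  (* Requiring [f] to vanish off [s] lets two representations be brought to a common support and
     added. *)
  pose Z : set W := [set w | exists (s : {fset I}) (f : I -> W),
    [/\ forall i, val i (f i), forall i, i \notin s -> f i = 0 &
        w = \sum_(i <- s) f i]]%classic.
  suff [s [f [Nf _ ->]]] : Z w by exists s, f.
  have widen (s t : {fset I}) (f : I -> W) : (forall i, i \notin s -> f i = 0) ->
      (s `<=` t)%fset -> \sum_(i <- s) f i = \sum_(i <- t) f i.
    by move=> f0 st; apply: big_fset_incl => // i _ /f0.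
  apply: (socle w _ (span_familyP F) (fun L => irreducible_sub_span PF maxF)).
    split.
    - by exists fset0, (fun=> 0); split=> //; rewrite big1.
    - move=> _ _ [s [f [Nf f0 ->]]] [t [g [Ng g0 ->]]].
      exists (s `|` t)%fset, (fun i => f i + g i); split.
      + by move=> i; have [[_ ND _ _] _ _] := irrF _ (FI i); apply: ND.
      + by move=> i; rewrite inE negb_or => /andP[/f0-> /g0->]; rewrite addr0.
      + by rewrite big_split /=; congr (_ + _); apply: widen => //;
          [exact: fsubsetUl|exact: fsubsetUr].
    - move=> a _ [s [f [Nf f0 ->]]]; exists s, (fun i => a *: f i); split.
      + by move=> i; have [[_ _ NZ _] _ _] := irrF _ (FI i); apply: NZ.
      + by move=> i /f0->; rewrite scaler0.
      + by rewrite scaler_sumr.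
    - move=> A _ [s [f [Nf f0 ->]]]; exists s, (fun i => rho A (f i)).
      pose rhoA : {linear W -> W} :=
        HB.pack (rho A) (GRing.isLinear.Build K W W *:%R (rho A) (rhoL A)).
      split.
      + by move=> i; have [[_ _ _ NA] _ _] := irrF _ (FI i); apply: NA.
      + by move=> i /f0->; apply: (linear0 rhoA).
      + exact: (linear_sum rhoA).
  move=> N FN u Nu; pose i : I := exist _ N (mem_set FN).
  exists [fset i]%fset, (fun j => if j == i then u else 0); split.
  - by move=> j; case: eqP => [->|].
  - by move=> j; rewrite inE => /negPf->.
  - by rewrite big_seq_fset1 eqxx.
(* Independence speaks of functions on all sets, so [f] is extended by 0 outside the family. *)
pose g N := if insub N is Some i then f i else 0 : W.
have gf (j : I) : g (val j) = f j by rewrite /g valK.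
rewrite -gf; apply: (indF (map val s) g) => //.
- by rewrite map_inj_uniq ?fset_uniq //; apply: val_inj.
- by move=> _ /mapP[j _ ->]; rewrite gf; split; [apply: FI|apply: Nf].
- by rewrite big_map -[RHS]sum0; apply: eq_bigr => j _; rewrite gf.
- exact: map_f.
Qed.

End DirectSum.

Theorem theorem2p11 (R : realType) (W : lmodType R[i])
    (rho : gl_infty R[i] -> W -> W) :
  is_gl_module rho -> in_Cint rho -> completely_reducible rho.
Proof.
move=> rhoP rhoC; apply: completely_reducible_of_socle.
  by case: rhoP.
move=> w; exact: (all_in_socle rhoP rhoC).
Qed.
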